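(* Let $d\ge 2$, $\Sigma=\{1,\dots,d\}$, let $\mathcal T=\Sigma^*$ be the $d$-regular rooted tree, and let $G<\mathrm{Aut}(\mathcal T)$ be a discrete group that is fractal and weakly branch. Let $P=\mathrm{Stab}_G(e)$ be the parabolic subgroup of $G$ associated with a ray $e\in\Sigma^{\mathbb N}$. Then $\mathrm{comm}_G(P)=P$.
   Context: The vertices of $\mathcal T=\Sigma^*$ are the finite words over $\Sigma$; the root is the empty word and the children of $\sigma$ are the words $\sigma s$, $s\in\Sigma$. $\mathrm{Aut}(\mathcal T)$ is the group of automorphisms of this rooted tree. ''Discrete'' means that $G$ is considered as an abstract group (with the discrete topology). All groups considered are spherically transitive: $G$ acts transitively on $\Sigma^n$ for every $n\in\mathbb N$. If $g\in\mathrm{Aut}(\mathcal T)$ fixes the word $\sigma$, then $g_{|\sigma}\in\mathrm{Aut}(\mathcal T)$ is defined by $g(\sigma\tau)=\sigma\,g_{|\sigma}(\tau)$. $\mathrm{Stab}_G(\sigma)$ is the stabilizer of $\sigma$ in $G$. $G$ is fractal if for every vertex $\sigma$ one has $\{g_{|\sigma}: g\in\mathrm{Stab}_G(\sigma)\}=G$ (under the identification of $\mathcal T$ with the subtree rooted at $\sigma$). For $g\in\mathrm{Aut}(\mathcal T)$, let $g^\sigma$ be the automorphism with $g^\sigma(\sigma\tau)=\sigma g(\tau)$ and $g^\sigma(\tau)=\tau$ if $\tau$ does not begin with $\sigma$. The rigid stabilizer is $\mathrm{Rist}_G(\sigma)=\{g^\sigma: g\in G\}\cap G$. $G$ is weakly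 branch if $\mathrm{Rist}_G(\sigma)$ is infinite for every vertex $\sigma$. A ray is an element $e\in\Sigma^{\mathbb N}$ (an infinite geodesic from the root), and $\mathrm{Stab}_G(e)$ is its stabilizer in $G$, called a parabolic subgroup. For a subgroup $H<G$, the commensurator is $\mathrm{comm}_G(H)=\{g\in G: H\cap H^g \text{ has finite index in both } H \text{ and } H^g\}$, where $H^g$ is the conjugate of $H$ by $g$. *)

(* Defs.v *)
From HB Require Import structures.
From mathcomp Require Import all_boot.
From mathcomp Require Import boolp classical_sets cardinality.

Set Implicit Arguments.
Unset Strict Implicit.
Unset Printing Implicit Defensive.

Local Open Scope group_scope.
Local Open Scope classical_set_scope.

(** The [d]-regular rooted tree: its vertices are the finite words over the
    [d]-letter alphabet ['I_d], and its root is the empty word. *)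
Definition word (d : nat) := seq 'I_d.

Definition is_child (d : nat) (u v : word d) : Prop := exists s, v = rcons u s.

Definition is_tree_aut (d : nat) (f : word d -> word d) : Prop :=
  [/\ bijective f, f [::] = [::]
    & forall u v, is_child (f u) (f v) <-> is_child u v].

Record treeAut (d : nat) := TreeAut {
  taut_fun :> word d -> word d;
  tautP : is_tree_aut taut_fun }.

Section TreeAutGroup.
Variable d : nat.
Implicit Types (f g h : treeAut d) (u v s t : word d).

Lemma treeAut_ext f g : (forall u, f u = g u) -> f = g.
Proof.
case: f g => [f fP] [g gP] /= /funext efg; case: g / efg gP => gP.
by congr TreeAut; apply: Prop_irrelevance.
Qed.

Lemma taut1_subproof : is_tree_aut (@id (word d)).
Proof. by split=> //; exists id. Qed.

Lemma tautM_subproof f g : is_tree_aut (f \o g).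
Proof.
case: (tautP f) (tautP g) => [bf f0 fc] [bg g0 gc]; split.
- exact: bij_comp.
- by rewrite /= g0.
- by move=> u v /=; rewrite fc gc.
Qed.

Definition taut_inv_fun f : word d -> word d :=
  let: And3 bf _ _ := tautP f in
  sval (cid (let: Bijective k fK kK := bf in
             ex_intro (fun k => cancel f k /\ cancel k f) k (conj fK kK))).

Lemma taut_inv_funK f : cancel f (taut_inv_fun f) /\ cancel (taut_inv_fun f) f.
Proof. by rewrite /taut_inv_fun; case: (tautP f) => bf _ _; case: cid. Qed.

Lemma tautV_subproof f : is_tree_aut (taut_inv_fun f).
Proof.
have [fK kK] := taut_inv_funK f; case: (tautP f) => _ f0 fc; split.
- by exists f.
- by rewrite -[in LHS]f0 fK.
- by move=> u v; rewrite -fc !kK.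
Qed.

Definition taut1 := TreeAut taut1_subproof.
Definition tautM f g := TreeAut (tautM_subproof f g).
Definition tautV f := TreeAut (tautV_subproof f).

Lemma tautMA : associative tautM. Proof. by move=> f g h; apply: treeAut_ext. Qed.
Lemma taut1M : left_id taut1 tautM. Proof. by move=> f; apply: treeAut_ext. Qed.
Lemma tautM1 : right_id taut1 tautM. Proof. by move=> f; apply: treeAut_ext. Qed.
Lemma tautVM : left_inverse taut1 tautV tautM.
Proof.
by move=> f; apply: treeAut_ext => u /=; case: (taut_inv_funK f) => fK _; apply: fK.
Qed.
Lemma tautMV : right_inverse taut1 tautV tautM.
Proof.
by move=> f; apply: treeAut_ext => u /=; case: (taut_inv_funK f) => _ kK; apply: kK.
Qed.

HB.instance Definition _ := gen_eqMixin (treeAut d).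
HB.instance Definition _ := gen_choiceMixin (treeAut d).
HB.instance Definition _ :=
  isGroup.Build (treeAut d) tautMA taut1M tautM1 tautVM tautMV.

(** The product of [treeAut d] is composition, acting on the left. *)
Lemma tautME f g u : (f * g) u = f (g u). Proof. by []. Qed.
Lemma taut1E u : (1 : treeAut d) u = u. Proof. by []. Qed.
Lemma tautK f : cancel f f^-1. Proof. by case: (taut_inv_funK f). Qed.
Lemma tautKV f : cancel f^-1 f. Proof. by case: (taut_inv_funK f). Qed.

Lemma taut_nil f : f [::] = [::]. Proof. by case: (tautP f). Qed.

Lemma taut_child f u v : is_child (f u) (f v) <-> is_child u v.
Proof. by case: (tautP f). Qed.

Lemma taut_cat f u v : exists w, f (u ++ v) = f u ++ w.
Proof.
elim/last_ind: v => [|v a [w IH]]; first by exists [::]; rewrite !cats0.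
have [b eb] : is_child (f (u ++ v)) (f (u ++ rcons v a)).
  by apply/taut_child; exists a; rewrite rcons_cat.
by exists (rcons w b); rewrite eb IH rcons_cat.
Qed.

(** The section [g_|s]; it is an automorphism even if [g] moves [s]. *)
Definition section_fun g s : word d -> word d :=
  fun t => drop (size (g s)) (g (s ++ t)).

Lemma section_funE g s t : g (s ++ t) = g s ++ section_fun g s t.
Proof. by rewrite /section_fun; case: (taut_cat g s t) => w ->; rewrite drop_size_cat. Qed.

Lemma cat_injr s : injective (cat s).
Proof. by move=> u v /eqP; rewrite eqseq_cat // eqxx => /eqP. Qed.

Lemma is_child_cat s u v : is_child (s ++ u) (s ++ v) <-> is_child u v.
Proof.
split=> [[a] | [a ->]]; last by exists a; rewrite rcons_cat.
by rewrite rcons_cat => /cat_injr ->; exists a.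
Qed.

Lemma section_subproof g s : is_tree_aut (section_fun g s).
Proof.
split.
- exists (section_fun g^-1 (g s)) => t.
    apply: (@cat_injr s); have := section_funE g^-1 (g s) (section_fun g s t).
    by rewrite -(section_funE g s t) !tautK.
  apply: (@cat_injr (g s)); rewrite -(section_funE g s).
  have := section_funE g^-1 (g s) t; rewrite tautK => <-.
  by rewrite tautKV.
- by rewrite /section_fun cats0 drop_size.
- by move=> u v; rewrite -(is_child_cat (g s)) -!(section_funE g s) taut_child is_child_cat.
Qed.

Definition tsection g s := TreeAut (section_subproof g s).

Lemma tsectionE g s t : g s = s -> g (s ++ t) = s ++ tsection g s t.
Proof. by move=> gs; rewrite section_funE gs. Qed.

(** The automorphism [g^s], acting as [g] on the subtree rooted at [s]. *)
Definition graft_fun s g : word d -> word d :=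
  fun u => if prefix s u then s ++ g (drop (size s) u) else u.

Lemma graft_fun_cat s g t : graft_fun s g (s ++ t) = s ++ g t.
Proof. by rewrite /graft_fun prefix_prefix drop_size_cat. Qed.

Lemma graft_fun_out s g u : ~~ prefix s u -> graft_fun s g u = u.
Proof. by rewrite /graft_fun => /negbTE ->. Qed.

Lemma graft_funK s f g : cancel f g -> cancel (graft_fun s f) (graft_fun s g).
Proof.
move=> fK u; have [/prefixP[t ->]|su] := boolP (prefix s u).
  by rewrite !graft_fun_cat fK.
by rewrite !graft_fun_out.
Qed.

Lemma graft_fun_child s g u v :
  is_child u v -> is_child (graft_fun s g u) (graft_fun s g v).
Proof.
move=> [a ->{v}]; have [/prefixP[t ->]|su] := boolP (prefix s u).
  rewrite rcons_cat !graft_fun_cat; apply/is_child_cat/taut_child.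
  by exists a.
rewrite (graft_fun_out _ su); exists a.
have [/prefixP[t]|sv] := boolP (prefix s (rcons u a)); last exact: graft_fun_out.
elim/last_ind: t => [|t b _].
  by rewrite cats0 => ->; rewrite -{2}[s]cats0 graft_fun_cat taut_nil cats0.
rewrite -rcons_cat => /rcons_inj[eu _].
by move: su; rewrite eu prefix_prefix.
Qed.

Lemma graft_subproof s g : is_tree_aut (graft_fun s g).
Proof.
have K1 := graft_funK s (tautK g); have K2 := graft_funK s (tautKV g).
split; first by exists (graft_fun s g^-1).
- by rewrite /graft_fun prefixs0; case: eqP => // ->; rewrite taut_nil.
- move=> u v; split; last exact: graft_fun_child.
  by move=> /(graft_fun_child s g^-1); rewrite !K1.
Qed.

Definition graft s g := TreeAut (graft_subproof s g).

Lemma graftE s g t : graft s g (s ++ t) = s ++ g t.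
Proof. exact: graft_fun_cat. Qed.

Lemma graft_out s g u : ~~ prefix s u -> graft s g u = u.
Proof. exact: graft_fun_out. Qed.

End TreeAutGroup.

Definition spherically_transitive (d : nat) (G : set (treeAut d)) : Prop :=
  forall n (u v : word d), size u = n -> size v = n -> exists2 g, G g & g u = v.

Definition vertex_stab (d : nat) (G : set (treeAut d)) (s : word d) :
  set (treeAut d) := [set g | G g /\ g s = s].

Definition fractal (d : nat) (G : set (treeAut d)) : Prop :=
  forall s : word d, [set tsection g s | g in vertex_stab G s] = G.

Definition rist (d : nat) (G : set (treeAut d)) (s : word d) :
  set (treeAut d) := [set graft s g | g in G] `&` G.

Definition weakly_branch (d : nat) (G : set (treeAut d)) : Prop :=
  forall s : word d, infinite_set (rist G s).

(** The vertices of the ray [e] are its finite prefixes [mkseq e n]; an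
    automorphism fixes [e] iff it fixes all of them. *)
Definition ray_stab (d : nat) (G : set (treeAut d)) (e : nat -> 'I_d) :
  set (treeAut d) := [set g | G g /\ forall n, g (mkseq e n) = mkseq e n].

Section Commensurator.
Variable gT : groupType.
Implicit Types G H K : set gT.

(** For [K] a subgroup of [H]: there are finitely many cosets [h K], [h] in
    [H]. *)
Definition finite_index K H : Prop :=
  finite_set [set [set h * k | k in K] | h in H].

Definition conj_set H (g : gT) : set gT := [set h ^ g | h in H].

Definition commensurator G H : set gT :=
  [set g | [/\ G g, finite_index (H `&` conj_set H g) H
             & finite_index (H `&` conj_set H g) (conj_set H g)]].

End Commensurator.

(* Main.v *)
(** Write [P^g] as the stabilizer of the ray [f = g^-1 e]. If [f] differs from
    [e], some vertex [s] lies on [f] but not on [e], so the rigid stabilizer of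
    [s] is contained in [P]. Were [P `&` P^g] of finite index in [P], the
    [P]-orbit of [f] would be finite, so that for some [m] every element of [P]
    fixing the [m]-th vertex of [f] would fix [f]. The automorphisms [h] in [G]
    whose copy at [s] lies in [G] form a normal subgroup [L] of [G] because [G]
    is fractal; normality and transitivity spread the previous property to all
    vertices of one level, so that an element of [L] is determined by its
    action on that level. Hence [L] is finite, against weak branching. *)
Require Import Defs.
From mathcomp Require Import all_boot.
From mathcomp Require Import boolp classical_sets cardinality.

Set Implicit Arguments.
Unset Strict Implicit.
Unset Printing Implicit Defensive.

Local Open Scope group_scope.
Local Open Scope classical_set_scope.

Section TreeAut.
Variable d : nat.
Implicit Types (f g h x y : treeAut d) (s t u v : word d).

Lemma taut_size g u : size (g u) = size u.
Proof.
elim/last_ind: u => [|u a IH]; first by rewrite taut_nil.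
have [b ->] : is_child (g u) (g (rcons u a)) by apply/taut_child; exists a.
by rewrite !size_rcons IH.
Qed.

Lemma taut_take g n u : g (take n u) = take n (g u).
Proof.
have [nu|/ltnW un] := leqP n (size u); last by rewrite !take_oversize ?taut_size.
have [w] := taut_cat g (take n u) (drop n u).
by rewrite cat_take_drop => ->; rewrite take_size_cat // taut_size size_take_min (minn_idPl nu).
Qed.

Lemma prefix_taut g s u : prefix (g s) (g u) = prefix s u.
Proof. by rewrite !prefixE taut_size -taut_take (can_eq (tautK g)). Qed.

Lemma graft1 s : graft s 1 = 1 :> treeAut d.
Proof.
apply: treeAut_ext => u; have [/prefixP[t ->]|su] := boolP (prefix s u).
  by rewrite graftE.
by rewrite graft_out.
Qed.

Lemma graftM s f g : graft s (f * g) = graft s f * graft s g.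
Proof.
apply: treeAut_ext => u; rewrite tautME.
have [/prefixP[t ->]|su] := boolP (prefix s u); first by rewrite !graftE.
by rewrite !graft_out.
Qed.

Lemma graftV s g : graft s g^-1 = (graft s g)^-1.
Proof. by apply: (@mulgI _ (graft s g)); rewrite -graftM !mulgV graft1. Qed.

(** Since [y] fixes [s], it permutes the vertices outside the subtree at [s], where the graft is
    trivial; inside, it acts through its section. *)
Lemma graft_conj y s h :
  y s = s -> y * graft s h * y^-1 = graft s (tsection y s * h * (tsection y s)^-1).
Proof.
move=> ys; set z := tsection y s.
suff E : y * graft s h = graft s (z * h * z^-1) * y by rewrite E mulgK.
apply: treeAut_ext => u; rewrite !tautME.
have [/prefixP[t ->]|su] := boolP (prefix s u).
  by rewrite graftE !(tsectionE _ ys) graftE !tautME tautK.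
by rewrite !graft_out // -{1}ys prefix_taut.
Qed.

End TreeAut.

Section SubgroupClosure.
Variables (gT : groupType) (G : set gT).
Hypothesis G_group : group_closed [in G].

Lemma groupset1 : G 1.
Proof. by case: G_group => /set_mem. Qed.

Lemma groupsetV x : G x -> G x^-1.
Proof. by move=> Gx; apply/set_mem/(group_closedV G_group)/mem_set. Qed.

Lemma groupsetM x y : G x -> G y -> G (x * y).
Proof. by move=> Gx Gy; apply/set_mem/(group_closedM G_group); apply/mem_set. Qed.

Lemma groupset_conj g x : G g -> G (x ^ g) <-> G x.
Proof.
move=> Gg; split=> Gx; last by rewrite conjgE; do !apply: groupsetM => //; apply: groupsetV.
rewrite -(conjgK g x) conjgE invgK.
by do !apply: groupsetM => //; apply: groupsetV.
Qed.

End SubgroupClosure.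

Lemma mem_conj_set (gT : groupType) (H : set gT) (g x : gT) :
  conj_set H g x <-> H (x ^ g^-1).
Proof.
split=> [[h Hh <-]|Hx]; first by rewrite conjgK.
by exists (x ^ g^-1); rewrite ?conjgKV.
Qed.

Lemma finite_index_refl (gT : groupType) (H : set gT) :
  group_closed [in H] -> finite_index H H.
Proof.
move=> H_group; apply: sub_finite_set (finite_set1 H) => _ [h Hh <-] /=.
apply/seteqP; split=> [_ [k Hk <-]|x Hx]; first exact: groupsetM.
exists (h^-1 * x); last by rewrite mulVKg.
by apply: groupsetM => //; apply: groupsetV.
Qed.

Section RayStabilizer.
Variables (d : nat) (G : set (treeAut d)) (e : nat -> 'I_d).
Hypothesis G_group : group_closed [in G].

Lemma ray_stab_group : group_closed [in ray_stab G e].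
Proof.
split; first by apply/mem_set; split; [exact: groupset1|].
move=> x y /set_mem[Gx xe] /set_mem[Gy ye]; apply/mem_set; split.
  by apply: groupsetM => //; apply: groupsetV.
by move=> n; rewrite tautME -[X in y^-1 X]ye tautK xe.
Qed.

Lemma conj_ray_stab_id g : ray_stab G e g -> conj_set (ray_stab G e) g = ray_stab G e.
Proof.
by move=> Pg; apply/predeqP => x; rewrite mem_conj_set groupset_conj //;
  [exact: ray_stab_group | exact: (groupsetV ray_stab_group)].
Qed.

Lemma ray_stab_commensurator : ray_stab G e `<=` commensurator G (ray_stab G e).
Proof.
move=> g Pg; rewrite /commensurator /= conj_ray_stab_id // setIid.
split; first by case: Pg.
  exact/finite_index_refl/ray_stab_group.
exact/finite_index_refl/ray_stab_group.
Qed.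

(** As [x ^ g] is [g^-1 * x * g], conjugation by [g] moves the fixed ray by [g^-1]. *)
Lemma conj_ray_stab g : G g ->
  conj_set (ray_stab G e) g =
  [set x | G x /\ forall n, x (g^-1 (mkseq e n)) = g^-1 (mkseq e n)].
Proof.
move=> Gg; apply/predeqP => x; rewrite mem_conj_set /ray_stab /mkset.
rewrite groupset_conj //; last exact: groupsetV.
rewrite conjgE invgK; split=> -[Gx xe]; split=> // n.
  by apply: (can_inj (tautK g)); rewrite [in RHS]tautKV -[in RHS](xe n) !tautME.
by rewrite !tautME xe tautKV.
Qed.

End RayStabilizer.

(* If some element of a coset [x Q] lies outside [Fix n], then so does the whole
   coset; take the largest of these [n] over the finitely many cosets. *)
Lemma finite_index_bounded (gT : groupType) (P Q : set gT) (Fix : nat -> set gT) :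
  finite_index Q P ->
  (forall m n, (m <= n)%N -> Fix n `<=` Fix m) ->
  (forall n x q, Q q -> Fix n (x * q) -> Fix n x) ->
  Q 1 ->
  exists m, forall x, P x -> Fix m x -> forall n, Fix n x.
Proof.
move=> /finite_seqP[C defC] Fix_mono Fix_coset Q1.
have /choice[m mP] (c : set gT) : exists m, forall x,
    [set x * k | k in Q] = c -> Fix m x -> forall n, Fix n x.
  have [[x [xc [m Fmx]]]|noF] :=
      pselect (exists x, [set x * k | k in Q] = c /\ exists m, ~ Fix m x); last first.
    (* The value 0 is arbitrary: no representative of [c] fails any [Fix n]. *)
    exists 0 => x xc _ n; apply: contrapT => nF; apply: noF.
    by exists x; split=> //; exists n.
  exists m => y yc Fmy; exfalso; apply: Fmx.
  have [q Qq qE] : [set x * k | k in Q] y by rewrite xc -yc; exists 1; rewrite ?mulg1.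
  by apply: (Fix_coset _ _ q Qq); rewrite qE.
exists (\max_(c <- C) m c) => x Px Fx; apply: (mP _ x erefl).
apply: Fix_mono Fx; apply: leq_bigmax_seq => //.
have : [set` C] [set x * k | k in Q] by rewrite -defC; exists x.
by [].
Qed.

Section NormalSubgroup.
Variables (d : nat) (G L : set (treeAut d)) (w : nat -> word d) (m : nat).
Hypothesis d_gt0 : (0 < d)%N.
Hypothesis G_group : group_closed [in G].
Hypothesis G_trans : spherically_transitive G.
Hypothesis L_group : group_closed [in L].
Hypothesis L_normal : forall x h, G x -> L h -> L (h ^ x).
Hypothesis size_w : forall n, size (w n) = n.
Hypothesis take_w : forall k n, (k <= n)%N -> take k (w n) = w k.
Hypothesis w_fix : forall h, L h -> h (w m) = w m -> forall n, h (w n) = w n.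

(** Some [x] in [G] carries a deep vertex [u] onto the ray [w]. The conjugate of [h] by [x^-1] is
    again in [L] and trivial on level [m], so it fixes the ray, and [h] fixes [u]. *)
Lemma normal_fix_level h : L h -> (forall v, size v = m -> h v = v) -> h = 1.
Proof.
move=> Lh hm; apply: treeAut_ext => u; rewrite taut1E.
have [mu|um] := leqP m (size u); last first.
  (* A vertex above level [m] is padded down to that level; any letter would do. *)
  pose v := u ++ nseq (m - size u) (Ordinal d_gt0).
  have -> : u = take (size u) v by rewrite take_size_cat.
  by rewrite taut_take hm // size_cat size_nseq subnKC // ltnW.
have [x Gx xu] := G_trans (erefl (size u)) (size_w (size u)).
have hx v : (h ^ x^-1) v = x (h (x^-1 v)) by rewrite conjgE invgK.
apply: (can_inj (tautK x)); rewrite xu -[u in LHS](tautK x) xu -hx.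
apply: w_fix; first by apply: L_normal => //; apply: groupsetV.
by rewrite hx -(take_w mu) -xu -taut_take tautK hm // size_takel.
Qed.

Lemma normal_finite_of_ray : finite_set L.
Proof.
(* The default of [insubd] never occurs, because [h] preserves length. *)
pose restr (h : treeAut d) := [ffun v : m.-tuple 'I_d => insubd v (h v)].
have restr_inj : {in L &, injective restr}.
  move=> a b /set_mem La /set_mem Lb /ffunP eab; apply: (@mulgI _ a^-1).
  rewrite mulVg; apply/esym/normal_fix_level.
    by apply: groupsetM => //; apply: groupsetV.
  move=> v /eqP sv; rewrite tautME; suff <- : a v = b v by rewrite tautK.
  have /(congr1 val) := eab (Tuple sv).
  by rewrite !ffunE !val_insubd /= !taut_size sv.
by rewrite -(eq_finite_set (inj_card_eq restr_inj)); apply: finite_finset.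
Qed.

End NormalSubgroup.

(** This is the copy of [rist G s] under the injective map [graft s], read at the root so that all
    of [G] can act on it by conjugation. *)
Definition rist_sections d (G : set (treeAut d)) (s : word d) : set (treeAut d) :=
  [set h | G h /\ G (graft s h)].

Section RistSections.
Variables (d : nat) (G : set (treeAut d)) (s : word d).
Hypothesis G_group : group_closed [in G].

Lemma rist_sections_group : group_closed [in rist_sections G s].
Proof.
split; first by apply/mem_set; split; rewrite ?graft1; exact: groupset1.
move=> x y /set_mem[Gx Gsx] /set_mem[Gy Gsy]; apply/mem_set; split.
  by apply: groupsetM => //; apply: groupsetV.
by rewrite graftM graftV; apply: groupsetM => //; apply: groupsetV.
Qed.

(** Fractality lifts [x^-1] to some [y] in the stabilizer of [s]; conjugating [graft s h] by [y]
    gives [graft s (h ^ x)]. *)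
Lemma rist_sections_normal (G_fractal : fractal G) x h :
  G x -> rist_sections G s h -> rist_sections G s (h ^ x).
Proof.
move=> Gx [Gh Gsh]; split; first exact/groupset_conj.
have [y [Gy ys] yx] : [set tsection y s | y in vertex_stab G s] x^-1.
  by rewrite G_fractal; apply: groupsetV.
rewrite conjgE mulgA -[X in _ * X]invgK -yx -graft_conj //.
by do !apply: groupsetM => //; apply: groupsetV.
Qed.

Lemma rist_finite : finite_set (rist_sections G s) -> finite_set (rist G s).
Proof.
move=> fin; apply: sub_finite_set (finite_image (graft s) fin).
by move=> _ [[h Gh <-] Gsh]; exists h.
Qed.

End RistSections.

Theorem mainTheorem2 (d : nat) (d_ge2 : 2 <= d) (G : set (treeAut d))
    (G_group : group_closed [in G])
    (G_trans : spherically_transitive G)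
    (G_fractal : fractal G)
    (G_wbranch : weakly_branch G)
    (e : nat -> 'I_d) :
  commensurator G (ray_stab G e) = ray_stab G e.
Proof.
apply/seteqP; split; last exact: ray_stab_commensurator.
move=> g [Gg + _]; rewrite (conj_ray_stab _ G_group Gg) => fin.
split=> // n0; apply: contrapT => gn0.
have take_e k n : (k <= n)%N -> take k (mkseq e n) = mkseq e k.
  by move=> kn; rewrite /mkseq -map_take take_iota (minn_idPl kn).
pose f n := g^-1 (mkseq e n).
have size_f n : size (f n) = n by rewrite taut_size size_mkseq.
have take_f k n : (k <= n)%N -> take k (f n) = f k.
  by move=> kn; rewrite -taut_take take_e.
pose s := f n0.
(* If [e] passed through [s], then [s] would be the vertex of [e] at level [n0], which [g] would
   then fix. *)
have s_e n : ~~ prefix s (mkseq e n).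
  apply/negP => se; have := size_prefix se.
  rewrite size_f size_mkseq => n0n; move: se.
  rewrite prefixE size_f take_e // => /eqP se; apply: gn0.
  by rewrite [in LHS]se tautKV.
have [|||m mP] := @finite_index_bounded (treeAut d) _ _
  (fun n => [set x : treeAut d | x (f n) = f n]) fin.
- by move=> k n kn x /= xf; rewrite -(take_f k n) // taut_take xf.
- by move=> n x q [_ [_ qf]]; rewrite /mkset tautME [q (f n)]qf.
- by split; [exact: groupset1 (ray_stab_group e G_group) | split; [exact: groupset1|]].
(* The tail of the ray [f] below [s], read as a ray from the root. *)
pose w n := drop n0 (f (n0 + n)%N).
have f_cat n : f (n0 + n)%N = s ++ w n.
  by rewrite -[LHS](cat_take_drop n0) take_f ?leq_addr.
apply: (G_wbranch s); apply: rist_finite.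
apply: (@normal_finite_of_ray _ G _ w m) => //.
- exact: ltnW.
- exact: rist_sections_group.
- by move=> x h; apply: rist_sections_normal.
- by move=> n; rewrite size_drop size_f addKn.
- by move=> k n kn; rewrite take_drop addnC take_f ?leq_add2l.
move=> h [Gh Gsh] hw n; apply: (@cat_injr _ s).
rewrite -graftE -f_cat; apply: mP.
  by split=> // k; apply: graft_out.
(* Level [m] of [w] is level [n0 + m] of [f], so fixing it also fixes the prefix [f m]. *)
rewrite /mkset -(take_f m (n0 + m)%N) ?leq_addl // taut_take.
by rewrite f_cat graftE hw.
Qed.
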